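(* Consider, over the horizon $t=0,\dots,T$, the linear time-varying system $x_{t+1}=A_tx_t+B_tu_t+w_t$ with $x_t,w_t\in\mathbb{R}^n$, $u_t\in\mathbb{R}^p$. Let $\mathbf{\Delta}$ be an arbitrary block-lower-triangular matrix with $n\times n$ blocks whose diagonal blocks are $\Delta^{0,0},\Delta^{1,0},\dots,\Delta^{T,0}$, and suppose that block-lower-triangular matrices $\{\mathbf{\Phi}_x,\mathbf{\Phi}_u\}$ satisfy $$\begin{bmatrix} I-Z\mathcal{A} & -Z\mathcal{B}\end{bmatrix}\begin{bmatrix}\mathbf{\Phi}_x\\ \mathbf{\Phi}_u\end{bmatrix}=I+\mathbf{\Delta}.$$ If $(I+\Delta^{i,0})^{-1}$ exists for $i=0,\dots,T$, then the controller $\mathbf{u}=\mathbf{K}\mathbf{x}$ with $\mathbf{K}=\mathbf{\Phi}_u\mathbf{\Phi}_x^{-1}$ achieves the system response $$\begin{bmatrix}\mathbf{x}\\ \mathbf{u}\end{bmatrix}=\begin{bmatrix}\mathbf{\Phi}_x\\ \mathbf{\Phi}_u\end{bmatrix}(I+\mathbf{\Delta})^{-1}\mathbf{w}.$$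
   Context: Signals are stacked over the horizon: $\mathbf{x}=(x_0,x_1,\dots,x_T)$, $\mathbf{u}=(u_0,u_1,\dots,u_T)$, $\mathbf{w}=(x_0,w_0,w_1,\dots,w_{T-1})$ (block column vectors with $T+1$ blocks). $Z$ is the block-downshift operator: the $(T+1)\times(T+1)$ block matrix (with $n\times n$ blocks) having identity matrices on the first block sub-diagonal and zeros elsewhere. $\mathcal{A}=\mathrm{blkdiag}(A_0,\dots,A_{T-1},0)$ and $\mathcal{B}=\mathrm{blkdiag}(B_0,\dots,B_{T-1},0)$. The dynamics are $\mathbf{x}=Z\mathcal{A}\mathbf{x}+Z\mathcal{B}\mathbf{u}+\mathbf{w}$. $\mathbf{\Phi}_x$ and $\mathbf{\Phi}_u$ are $(T+1)\times(T+1)$ block-lower-triangular with $n\times n$ and $p\times n$ blocks respectively. The block of $\mathbf{\Delta}$ in block row $i$ and block column $i-j$ is denoted $\Delta^{i,j}$ for $0\le j\le i\le T$, with rows and columns indexed from $0$, so $\Delta^{i,0}$ is the $i$-th diagonal block. A controller achieves a response if the closed-loop maps $\mathbf{w}\mapsto\mathbf{x}$ and $\mathbf{w}\mapsto\mathbf{u}$ under $\mathbf{u}=\mathbf{K}\mathbf{x}$ equal the stated ones. *)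

(* Defs.v *)
From mathcomp Require Import all_boot all_order all_algebra.
From mathcomp Require Import reals.
Set Implicit Arguments.
Unset Strict Implicit.
Unset Printing Implicit Defensive.
Import GRing.Theory.
Local Open Scope ring_scope.

(* Total size of T+1 blocks of size n.  This is the form of the dimensions of
   \mxblock and \mxcol, so that submxblock and submxcol apply directly. *)
Notation bdim T n := (\sum_(i < T.+1) n)%N.

Section Blocks.
Variables (R : realType) (T : nat).

Definition block_lower (m k : nat) (M : 'M[R]_(bdim T m, bdim T k)) : Prop :=
  forall i j : 'I_T.+1, (i < j)%N -> submxblock M i j = 0.

(* The library's \mxdiag only has square diagonal blocks; here they may be
   rectangular. *)
Definition blkdiag (m k : nat) (D : 'I_T.+1 -> 'M[R]_(m, k)) :
    'M[R]_(bdim T m, bdim T k) :=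
  \mxblock_(i < T.+1, j < T.+1) (if i == j then D i else 0 : 'M[R]_(m, k)).

Definition downshift (n : nat) : 'M[R]_(bdim T n) :=
  \mxblock_(i < T.+1, j < T.+1) (if i == j.+1 :> nat then 1%:M else 0 : 'M[R]_n).

(* D_0, ..., D_{T-1}, 0 : unlift ord_max is None exactly at index T, and
   otherwise returns the same index in 'I_T. *)
Definition pad_last (m k : nat) (D : 'I_T -> 'M[R]_(m, k)) (i : 'I_T.+1) :
    'M[R]_(m, k) :=
  if unlift ord_max i is Some t then D t else 0.

Definition stack (n : nat) (s : 'I_T.+1 -> 'cV[R]_n) : 'cV[R]_(bdim T n) :=
  \mxcol_(i < T.+1) s i.

(* x_0, w_0, ..., w_{T-1} : w_t sits at index t+1. *)
Definition prepend (n : nat) (x0 : 'cV[R]_n) (w : 'I_T -> 'cV[R]_n)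
    (i : 'I_T.+1) : 'cV[R]_n :=
  if unlift ord0 i is Some t then w t else x0.

End Blocks.

Section System.
Variables (R : realType) (T n p : nat).
Variables (A : 'I_T -> 'M[R]_n) (B : 'I_T -> 'M[R]_(n, p)).

(* For t : 'I_T, [lift ord_max t] is t and [lift ord0 t] is t+1 in 'I_T.+1. *)
Definition ltv_trajectory (x0 : 'cV[R]_n) (w : 'I_T -> 'cV[R]_n)
    (x : 'I_T.+1 -> 'cV[R]_n) (u : 'I_T.+1 -> 'cV[R]_p) : Prop :=
  x ord0 = x0 /\
  forall t : 'I_T,
    x (lift ord0 t) =
      A t *m x (lift ord_max t) + B t *m u (lift ord_max t) + w t.

(* The equivalence says that, under u = K x, every w determines exactly one
   trajectory (x, u), and that w |-> (x, u) is the map given by Resp. *)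
Definition achieves (K : 'M[R]_(bdim T p, bdim T n))
    (Resp : 'M[R]_(bdim T n + bdim T p, bdim T n)) : Prop :=
  forall (x0 : 'cV[R]_n) (w : 'I_T -> 'cV[R]_n)
         (x : 'I_T.+1 -> 'cV[R]_n) (u : 'I_T.+1 -> 'cV[R]_p),
    (ltv_trajectory x0 w x u /\ stack u = K *m stack x) <->
    col_mx (stack x) (stack u) = Resp *m stack (prepend x0 w).

Lemma downshift_blkdiag_stack (k : nat) (D : 'I_T -> 'M[R]_(n, k))
    (s : 'I_T.+1 -> 'cV[R]_k) :
  downshift R T n *m blkdiag (pad_last D) *m stack s =
  stack (prepend 0 (fun t => D t *m s (lift ord_max t))).
Proof.
have DsE : blkdiag (pad_last D) *m stack s =
    stack (fun i => pad_last D i *m s i).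
  apply: etrans (@mul_mxblock_mxrow R _ _ (fun=> k) (fun=> n) _ _ _) _.
  apply: eq_mxcol => i; rewrite (bigD1 i) //= eqxx big1 ?addr0 // => j ji.
  by rewrite eq_sym (negbTE ji) mul0mx.
rewrite -mulmxA DsE.
apply: etrans (@mul_mxblock_mxrow R _ _ (fun=> n) (fun=> n) _ _ _) _.
apply: eq_mxcol => i; rewrite /prepend.
case: unliftP => [t ->|->]; last by rewrite big1 // => j _; rewrite mul0mx.
rewrite (bigD1 (lift ord_max t)) // big1.
  rewrite [LHS]addr0 lift0 lift_max eqxx mul1mx /pad_last.
  by rewrite liftK.
move=> j jt; rewrite lift0 eqSS ifN ?mul0mx //.
by apply: contra jt => /eqP e; apply/eqP/val_inj; rewrite [RHS]lift_max.
Qed.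

(* The recursion is the stacked equation x = Z A x + Z B u + w. *)
Lemma ltv_trajectoryE x0 w x u :
  ltv_trajectory x0 w x u <->
  stack x = downshift R T n *m blkdiag (pad_last A) *m stack x
          + downshift R T n *m blkdiag (pad_last B) *m stack u
          + stack (prepend x0 w).
Proof.
rewrite !downshift_blkdiag_stack /stack -!mxcolD; split=> [[x0E xE]|].
  apply: eq_mxcol => i; rewrite /prepend.
  by case: unliftP => [t ->|->]; rewrite ?xE // x0E !add0r.
move=> /eq_mxcolP xE; split=> [|t]; rewrite xE /prepend.
  by rewrite unlift_none !add0r.
by rewrite liftK.
Qed.

End System.

(* Main.v *)
(** The shift [Z] has zero diagonal blocks, so the constraint forces the diagonal
    blocks of [Phix] to be those of [I + Delta]; both matrices are then invertible,
    being block lower triangular with invertible diagonal blocks.  Substituting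
    [y = Phix^-1 x] in the closed loop turns the dynamics into
    [(I + Delta) y = w], with [x = Phix y] and [u = Phiu y]. *)

Require Import Defs.
From mathcomp Require Import all_boot all_order all_algebra.
From mathcomp Require Import reals.
Import GRing.Theory.
Local Open Scope ring_scope.

Lemma submxblock_mul (R : realType) (T m k l : nat)
    (M : 'M[R]_(bdim T m, bdim T k)) (N : 'M[R]_(bdim T k, bdim T l))
    (i j : 'I_T.+1) :
  submxblock (M *m N) i j =
  \sum_(h < T.+1) submxblock M i h *m submxblock N h j.
Proof.
rewrite -{1}[M]submxblockK -{1}[N]submxblockK mul_mxblock.
exact: (@mxblockK R _ _ (fun=> m) (fun=> l)).
Qed.

Lemma block_lower_mul {R : realType} {T m k l : nat}
    {M : 'M[R]_(bdim T m, bdim T k)} {N : 'M[R]_(bdim T k, bdim T l)} :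
  block_lower M -> block_lower N -> block_lower (M *m N).
Proof.
move=> lowM lowN i j ij; rewrite submxblock_mul big1 // => h _.
case: (ltnP i h) => [ih|hi]; first by rewrite lowM // mul0mx.
by rewrite lowN ?mulmx0 // (leq_ltn_trans hi).
Qed.

(** In the sum over the middle index [h], the block of [N] vanishes for [h < i] and that of [M] for
    [h > i]. *)
Lemma submxblock_mul_diag (R : realType) (T m k l : nat)
    (M : 'M[R]_(bdim T m, bdim T k)) (N : 'M[R]_(bdim T k, bdim T l))
    (i : 'I_T.+1) :
  block_lower M -> block_lower N ->
  submxblock (M *m N) i i = submxblock M i i *m submxblock N i i.
Proof.
move=> lowM lowN; rewrite submxblock_mul (bigD1 i) //= big1 ?addr0 // => h.
rewrite neq_ltn => /orP[hi|ih]; first by rewrite lowN // mulmx0.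
by rewrite lowM // mul0mx.
Qed.

Lemma block_lower_blkdiag {R : realType} {T m k : nat}
    (D : 'I_T.+1 -> 'M[R]_(m, k)) : block_lower (blkdiag D).
Proof.
move=> i j ij; rewrite /blkdiag.
apply: etrans (@mxblockK R _ _ (fun=> m) (fun=> k) _ i j) _.
by rewrite ifN // neq_ltn ij.
Qed.

(** The case [i = j] is the one that removes the dynamics from the diagonal of the constraint. *)
Lemma submxblock_downshift_le (R : realType) (T n : nat) (i j : 'I_T.+1) :
  (i <= j)%N -> submxblock (downshift R T n) i j = 0.
Proof.
move=> ij; rewrite /downshift.
apply: etrans (@mxblockK R _ _ (fun=> n) (fun=> n) _ i j) _.
by rewrite ifN // neq_ltn ltnS ij.
Qed.

Lemma block_lower_downshift (R : realType) (T n : nat) :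
  block_lower (downshift R T n).
Proof. by move=> i j /ltnW; exact: submxblock_downshift_le. Qed.

Lemma submxblock_downshift_mul_diag (R : realType) (T n m k : nat)
    (D : 'I_T.+1 -> 'M[R]_(n, m)) (M : 'M[R]_(bdim T m, bdim T k))
    (i : 'I_T.+1) :
  block_lower M -> submxblock (downshift R T n *m blkdiag D *m M) i i = 0.
Proof.
move=> lowM; have lowDM := block_lower_mul (block_lower_blkdiag D) lowM.
rewrite -mulmxA submxblock_mul_diag //; last exact: block_lower_downshift.
by rewrite submxblock_downshift_le // mul0mx.
Qed.

Lemma block_lower_scalar {R : realType} {T n : nat} (a : R) :
  block_lower (a%:M : 'M_(bdim T n)).
Proof.
(* A scalar matrix of the total size is the block diagonal of scalar blocks. *)
move=> i j ij; rewrite -(@mxdiagZ R _ (fun=> n)) /mxdiag.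
apply: etrans (@mxblockK R _ _ (fun=> n) (fun=> n) _ i j) _.
by rewrite ifN // neq_ltn ij.
Qed.

Lemma submxblock_scalar_diag (R : realType) (T n : nat) (a : R) (i : 'I_T.+1) :
  submxblock (a%:M : 'M_(bdim T n)) i i = a%:M.
Proof.
rewrite -(@mxdiagZ R _ (fun=> n)).
exact: (@submxblock_diag R _ (fun=> n)).
Qed.

Lemma block_lower_unitmx (R : realType) (T n : nat) (M : 'M[R]_(bdim T n)) :
  block_lower M -> (forall i : 'I_T.+1, submxblock M i i \in unitmx) ->
  M \in unitmx.
Proof.
(* Forward substitution in [M *m cokermx M = 0], block row by block row. *)
move=> lowM diagM; rewrite -row_full_unit -cokermx_eq0; apply/eqP.
apply/(@mxblockP R _ _ (fun=> n) (fun=> n)) => i j; rewrite submxblock0.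
(* Strong induction on the block row [i], with the block column [j] fixed. *)
have [k] := ubnP i; elim: k i => // k IH i; rewrite ltnS => ik.
have := submxblock_mul _ _ _ _ _ M (cokermx M) i j.
rewrite mulmx_coker submxblock0 (bigD1 i) //=.
(* Terms with [h < i] vanish by induction and those with [h > i] by triangularity. What remains is
   the invertible block [M i i] times the unknown block. *)
rewrite [X in _ = _ + X]big1 => [|h].
  rewrite addr0 => /(congr1 (mulmx (invmx (submxblock M i i)))).
  by rewrite mulmx0 mulKmx.
rewrite neq_ltn => /orP[hi|ih]; last by rewrite lowM // mul0mx.
by rewrite IH ?mulmx0 // (leq_trans hi).
Qed.

Theorem theorem2p2 (R : realType) (T n p : nat)
    (A : 'I_T -> 'M[R]_n) (B : 'I_T -> 'M[R]_(n, p))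
    (Delta Phix : 'M[R]_(bdim T n)) (Phiu : 'M[R]_(bdim T p, bdim T n))
    (hDelta : block_lower Delta)
    (hPhix : block_lower Phix) (hPhiu : block_lower Phiu)
    (hPhi : row_mx (1%:M - downshift R T n *m blkdiag (pad_last A))
                   (- (downshift R T n *m blkdiag (pad_last B)))
            *m col_mx Phix Phiu = 1%:M + Delta)
    (hinv : forall i : 'I_T.+1, 1%:M + submxblock Delta i i \in unitmx) :
  [/\ Phix \in unitmx,
      1%:M + Delta \in unitmx &
      achieves A B (Phiu *m invmx Phix)
        (col_mx Phix Phiu *m invmx (1%:M + Delta))].
Proof.
have {}hPhi : 1%:M + Delta = Phix
    - downshift R T n *m blkdiag (pad_last A) *m Phix
    - downshift R T n *m blkdiag (pad_last B) *m Phiu.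
  by rewrite -hPhi mul_row_col mulmxBl mul1mx mulNmx.
have diagPhix (i : 'I_T.+1) :
    submxblock Phix i i = 1%:M + submxblock Delta i i.
  rewrite -(submxblock_scalar_diag _ T _ _ i) -submxblockD hPhi !submxblockB.
  by rewrite !submxblock_downshift_mul_diag // !subr0.
have uPhix : Phix \in unitmx.
  by apply: block_lower_unitmx => // i; rewrite diagPhix.
have uDelta : 1%:M + Delta \in unitmx.
  apply: block_lower_unitmx => [i j ij|i].
    by rewrite submxblockD block_lower_scalar // hDelta // addr0.
  by rewrite submxblockD submxblock_scalar_diag.
split=> // x0 w x u; rewrite ltv_trajectoryE !mul_col_mx -!mulmxA.
set W := stack (prepend x0 w).
split=> [[xE uE]|/eq_col_mx[xE uE]].
  (* With [y = Phix^-1 x], the equation [W = (I + Delta) y] yields both responses: [Phix y = x], and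
     [Phiu y = K x = u]. *)
  suff -> : W = (1%:M + Delta) *m (invmx Phix *m stack x).
    by rewrite mulKmx // mulKVmx // -uE.
  (* By the constraint, [(I + Delta) y = x - Z A x - Z B u], which is [W] by the dynamics. *)
  rewrite hPhi !mulmxBl -!(mulmxA _ Phix) -(mulmxA _ Phiu) mulKVmx // -uE.
  by rewrite -[RHS]addrA -opprD {1}xE !mulmxA addrAC subrr add0r.
(* Conversely, put [y = (I + Delta)^-1 W]. Then [x = Phix y], so [K x = Phiu y = u]. *)
split; last by rewrite xE mulKmx.
(* The fourth [W] is the disturbance term of the dynamics. Written as [(I + Delta) y], it turns the
   goal into the constraint applied to [y]. *)
rewrite uE xE -{4}[W](mulKVmx uDelta).
by rewrite hPhi !mulmxBl !mulmxA -[X in _ = _ + X]addrA -opprD [RHS]addrC subrK.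
Qed.
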